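(* Let $\beta>0$ and $\varepsilon\in(0,1]$. Let $\pi_0=\pi_{\mathrm{ref}}$ and, for $n\ge1$, let $\pi_n$ be the maximizer over all policies $\pi$ of the Mirror-GRPO objective (with $\alpha=0$, i.e. regularization to the previous iterate only) $$\mathbb{E}_{q\sim\rho_{\mathcal Q}}\Big(\mathbb{E}_{o\sim\pi(\cdot|q)}A_{n-1}(q,o)-\beta\,\mathsf{KL}\big(\pi(\cdot|q)\,\|\,\pi_{n-1}(\cdot|q)\big)\Big),$$ where $A_{n-1}(q,o)=\omega^+_\varepsilon(p_{n-1}(q))$ if $r(q,o)=1$, $A_{n-1}(q,o)=-\omega^-_\varepsilon(p_{n-1}(q))$ if $r(q,o)=0$, and $p_{n-1}(q)=\mathbb{P}_{o\sim\pi_{n-1}(\cdot|q)}(r(q,o)=1)$. Then, for $\rho_{\mathcal Q}$-almost every $q$ and all $n\ge1$: 1. (Optimal policy) The maximizer is $$\pi_n(o|q)=\frac{1}{Z_{n-1}(q)}\pi_{n-1}(o|q)\exp\!\left(\frac1\beta\Big(\omega^+_\varepsilon(p_{n-1}(q))\mathbf 1_{r(q,o)=1}-\omega^-_\varepsilon(p_{n-1}(q))\mathbf 1_{r(q,o)=0}\Big)\right)$$ (for almost every $o$), where $Z_{n-1}(q)=p_{n-1}(q)\exp\big(\tfrac1\beta\omega^+_\varepsilon(p_{n-1}(q))\big)+(1-p_{n-1}(q))\exp\big(-\tfrac1\beta\omega^-_\varepsilon(p_{n-1}(q))\big)$. 2. (Recurrences) The probability of success $p_n(q)$ of $\pi_n(\cdot|q)$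 satisfies $$\mathrm{logit}(p_n(q))=\mathrm{logit}(p_{n-1}(q))+\frac{\Omega_\varepsilon(p_{n-1}(q))}{\beta},\qquad p_n(q)=\sigma\!\Big(\mathrm{logit}(p_{n-1}(q))+\Omega_\varepsilon(p_{n-1}(q))/\beta\Big).$$
   Context: $\rho_{\mathcal Q}$ is a probability distribution on the prompt space $\mathcal Q$; $\mathcal O$ is the outcome space with a fixed $\sigma$-finite base measure (counting measure when $\mathcal O$ is countable). A policy $\pi$ assigns (measurably) to each $q$ a probability density $\pi(\cdot|q)$ on $\mathcal O$. The reward $r:\mathcal Q\times\mathcal O\to\{0,1\}$ is measurable; $\pi_{\mathrm{ref}}$ is a fixed reference policy. $\mathsf{KL}$ is the Kullback–Leibler divergence, with values in $[0,\infty]$ (the objective is $-\infty$ when the expected divergence is infinite). $\omega^+_{\varepsilon}(p)=\frac{1-p}{\sqrt{p(1-p)+\varepsilon}}$, $\omega^-_{\varepsilon}(p)=\frac{p}{\sqrt{p(1-p)+\varepsilon}}$, $\Omega_\varepsilon(p)=\frac{1}{\sqrt{p(1-p)+\varepsilon}}$ for $p\in[0,1]$. $\mathrm{logit}(p)=\log\frac{p}{1-p}$ and $\sigma(x)=\frac1{1+e^{-x}}$, with the conventions $\mathrm{logit}(0)=-\infty$, $\mathrm{logit}(1)=+\infty$, $\sigma(-\infty)=0$, $\sigma(+\infty)=1$. *)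

(* Defs.v *)
From mathcomp Require Import all_boot all_order all_algebra.
From mathcomp Require Import all_classical all_reals all_analysis.

Set Implicit Arguments.
Unset Strict Implicit.
Unset Printing Implicit Defensive.

Import Order.TTheory GRing.Theory Num.Theory.
Import numFieldNormedType.Exports.
Local Open Scope classical_set_scope.
Local Open Scope ring_scope.

Definition Omega_eps {R : realType} (eps p : R) : R :=
  (Num.sqrt (p * (1 - p) + eps))^-1.

Definition omega_plus {R : realType} (eps p : R) : R :=
  (1 - p) / Num.sqrt (p * (1 - p) + eps).

Definition omega_minus {R : realType} (eps p : R) : R :=
  p / Num.sqrt (p * (1 - p) + eps).

Definition logit {R : realType} (p : R) : \bar R :=
  if p == 0 then -oo%E else if p == 1 then +oo%E else (ln (p / (1 - p)))%:E.

Definition sigmoid {R : realType} (x : \bar R) : R :=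
  match x with
  | EFin t => (1 + expR (- t))^-1
  | +oo%E => 1
  | -oo%E => 0
  end.

(* [pi q o] is the density pi(o|q) with respect to the base measure [mu]. *)
Definition is_policy {R : realType} {dQ dO : measure_display}
    {Q : measurableType dQ} {O : measurableType dO}
    (mu : {sigma_finite_measure set O -> \bar R}) (pi : Q -> O -> R) : Prop :=
  [/\ measurable_fun [set: Q * O] (fun x : Q * O => pi x.1 x.2),
      forall q o, 0 <= pi q o
    & forall q, (\int[mu]_o (pi q o)%:E = 1)%E].

(* The conventions 0 log (0 / b) = 0 and a log (a / 0) = +oo for a > 0 give the
   value +oo when f mu is not absolutely continuous with respect to g mu.  For
   probability densities the integral never has the form +oo - oo, because
   a log (a / b) >= a - b. *)
Definition KL {R : realType} {dO : measure_display} {O : measurableType dO}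
    (mu : {sigma_finite_measure set O -> \bar R}) (f g : O -> R) : \bar R :=
  (\int[mu]_o (if f o == 0%R then 0
               else if g o == 0%R then +oo
               else (f o * ln (f o / g o))%:E))%E.

Definition success_prob {R : realType} {dQ dO : measure_display}
    {Q : measurableType dQ} {O : measurableType dO}
    (mu : {sigma_finite_measure set O -> \bar R}) (r : Q -> O -> bool)
    (pi : Q -> O -> R) (q : Q) : R :=
  fine (\int[mu]_(o in [set o | r q o = true]) (pi q o)%:E)%E.

Definition advantage {R : realType} (eps p : R) (rew : bool) : R :=
  if rew then omega_plus eps p else - omega_minus eps p.

(* The advantages are bounded, so the outer integrand is bounded above and the
   objective is -oo exactly when the expected divergence is infinite. *)
Definition mirror_grpo_objective {R : realType} {dQ dO : measure_display}
    {Q : measurableType dQ} {O : measurableType dO}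
    (rho : probability Q R) (mu : {sigma_finite_measure set O -> \bar R})
    (r : Q -> O -> bool) (beta eps : R) (pi_old pi : Q -> O -> R) : \bar R :=
  (\int[rho]_q
     ((\int[mu]_o (advantage eps (success_prob mu r pi_old q) (r q o)
                   * pi q o)%:E)
      - beta%:E * KL mu (pi q) (pi_old q)))%E.

Definition is_policy_maximizer {R : realType} {dQ dO : measure_display}
    {Q : measurableType dQ} {O : measurableType dO}
    (mu : {sigma_finite_measure set O -> \bar R})
    (J : (Q -> O -> R) -> \bar R) (pi : Q -> O -> R) : Prop :=
  is_policy mu pi /\ forall pi', is_policy mu pi' -> (J pi' <= J pi)%E.

Definition mirror_grpo_iterates {R : realType} {dQ dO : measure_display}
    {Q : measurableType dQ} {O : measurableType dO}
    (rho : probability Q R) (mu : {sigma_finite_measure set O -> \bar R})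
    (r : Q -> O -> bool) (beta eps : R) (pi_ref : Q -> O -> R)
    (pi : nat -> Q -> O -> R) : Prop :=
  pi 0%N = pi_ref /\
  forall n, is_policy_maximizer mu
    (mirror_grpo_objective rho mu r beta eps (pi n)) (pi n.+1).

Definition mirror_grpo_Z {R : realType} (beta eps p : R) : R :=
  p * expR (beta^-1 * omega_plus eps p)
  + (1 - p) * expR (- (beta^-1 * omega_minus eps p)).

(* Main.v *)
(* Gibbs' variational principle.  For densities f, g and a bounded advantage A,
   the tilted density g^ = g exp(A / beta) / Z satisfies
     E_f A - beta KL(f || g) = beta log Z - beta KL(f || g^),
   so the objective of a policy pi is the finite constant E_rho (beta log Z)
   minus beta E_rho KL(pi || g^).  The tilted policy attains the constant, and
   any other maximizer has KL(pi(.|q) || g^(.|q)) = 0, hence equals g^, for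
   almost every q.  The recurrence is the ratio of the masses that g^ gives to
   success and failure, since omega+ + omega- = Omega.  KL(f || g^) is handled
   as the integral of f log(f / g^) - f + g^ >= 0. *)
Require Import Defs.
From mathcomp Require Import all_boot all_order all_algebra.
From mathcomp Require Import all_classical all_reals all_analysis.
From mathcomp Require Import measurable_realfun ring lra.
Import Order.TTheory GRing.Theory Num.Theory.
Import numFieldNormedType.Exports.
Local Open Scope classical_set_scope.
Local Open Scope ring_scope.

(** * Extended integrals of a nonnegative function plus an integrable one *)

(** Since [h >= 0], the negative part of [h + v] is at most [|v|]. *)
Lemma ge0_integral_funeneg_lty (R : realType) (d : measure_display)
    (T : measurableType d) (mu : {measure set T -> \bar R})
    (h : T -> \bar R) (v : T -> R) :
  measurable_fun [set: T] h -> (forall x, 0 <= h x)%E ->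
  mu.-integrable [set: T] (EFin \o v) ->
  (\int[mu]_x (fun x => h x + (v x)%:E)^\- x < +oo)%E.
Proof.
move=> mh h0 iv; have /integrableP[mv] := iv; apply: le_lt_trans.
have mhv : measurable_fun [set: T] (fun x => h x + (v x)%:E)%E.
  exact: emeasurable_funD.
apply: ge0_le_integral => //.
- exact: measurable_funeneg.
- exact: measurableT_comp.
- move=> x _; rewrite funenegE ge_max abse_ge0 andbT leeNl.
  apply: (@le_trans _ _ (v x)%:E); last by rewrite leeDr.
  by rewrite leeNl -[leRHS]abseN lee_abs.
Qed.

(** Additivity when [h] may have infinite integral, as a divergence may. In that case the positive
    part of [h + v] has infinite integral and the negative part a finite one, so both sides are
    [+oo]. *)
Lemma ge0_integralDr (R : realType) (d : measure_display)
    (T : measurableType d) (mu : {measure set T -> \bar R})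
    (h : T -> \bar R) (v : T -> R) :
  measurable_fun [set: T] h -> (forall x, 0 <= h x)%E ->
  mu.-integrable [set: T] (EFin \o v) ->
  (\int[mu]_x (h x + (v x)%:E) = \int[mu]_x h x + \int[mu]_x (v x)%:E)%E.
Proof.
move=> mh h0 iv.
have [ih|nih] := pselect (mu.-integrable [set: T] h); first exact: integralD.
have /integrableP[mv lt_abs] := iv.
have mhv : measurable_fun [set: T] (fun x => h x + (v x)%:E)%E.
  exact: emeasurable_funD.
have inth : (\int[mu]_x h x = +oo)%E.
  apply/eqP; rewrite -leye_eq leNgt; apply/negP => lth; apply: nih.
  apply/integrableP; split=> //.
  by under eq_integral do rewrite gee0_abs//.
have mabs : measurable_fun [set: T] (fun x => `|(v x)%:E|)%E.
  exact: measurableT_comp.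
have intv : (\int[mu]_x (v x)%:E)%E \is a fin_num by exact: integrable_fin_num.
(* From [h <= (h + v)^+ + |v|], a finite integral of the positive part would make the integral of
   [h] finite. *)
have pos : (\int[mu]_x (fun x => h x + (v x)%:E)^\+ x = +oo)%E.
  apply/eqP; rewrite -leye_eq leNgt; apply/negP => ltp.
  suff : (\int[mu]_x h x < +oo)%E by rewrite inth ltxx.
  apply: (@le_lt_trans _ _
    (\int[mu]_x ((fun x => h x + (v x)%:E)^\+ x + `|(v x)%:E|))%E).
    apply: ge0_le_integral => //.
    - by apply: emeasurable_funD => //; exact: measurable_funepos.
    - move=> x _; rewrite funeposE.
      apply: (@le_trans _ _ (h x + (v x)%:E + `|(v x)%:E|)%E).
        rewrite -addeA leeDl// -EFinD lee_fin -lerBlDl sub0r.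
        by rewrite -normrN ler_norm.
      by rewrite leeD2r// le_max lexx.
  rewrite ge0_integralD//; first by rewrite lte_add_pinfty.
  exact: measurable_funepos.
rewrite inth addye; last by case/fin_numP: intv.
rewrite integralE pos addye//.
have := ge0_integral_funeneg_lty _ _ _ _ _ _ mh h0 iv.
by rewrite lt_neqAle eqe_oppLR /= => /andP[].
Qed.

(** The negation of the additive case. The sign leaves the integral because the negative part of
    [h - v] has finite integral; the common value may be [-oo]. *)
Lemma ge0_integralBr (R : realType) (d : measure_display)
    (T : measurableType d) (mu : {measure set T -> \bar R})
    (h : T -> \bar R) (v : T -> R) :
  measurable_fun [set: T] h -> (forall x, 0 <= h x)%E ->
  mu.-integrable [set: T] (EFin \o v) ->
  (\int[mu]_x ((v x)%:E - h x) = \int[mu]_x (v x)%:E - \int[mu]_x h x)%E.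
Proof.
move=> mh h0 iv.
have iNv : mu.-integrable [set: T] (EFin \o (fun x => - v x)).
  exact: (integrableN iv).
have Nint : (\int[mu]_x (- v x)%:E = - \int[mu]_x (v x)%:E)%E.
  rewrite -integralN//.
  by apply: fin_num_adde_defl; rewrite fin_numN; exact: (integrable_neg_fin_num _ iv).
have -> : (\int[mu]_x ((v x)%:E - h x) = \int[mu]_x - (h x + (- v x)%:E))%E.
  apply: eq_integral => x _.
  by rewrite EFinN fin_num_oppeB// addeC.
rewrite integralN; last first.
  apply: fin_num_adde_defl; rewrite fin_numN ge0_fin_numE.
    exact: ge0_integral_funeneg_lty.
  exact: integral_ge0.
rewrite ge0_integralDr// Nint fin_num_oppeB 1?addeC//.
by rewrite integrable_fin_num.
Qed.

Lemma ge0_integral_eq0_ae (R : realType) (d : measure_display)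
    (T : measurableType d) (mu : {measure set T -> \bar R}) (h : T -> \bar R) :
  measurable_fun [set: T] h -> (forall x, 0 <= h x)%E ->
  (\int[mu]_x h x = 0)%E -> {ae mu, forall x, h x = 0%E}.
Proof.
move=> mh h0 ih; have /ae_eq_integral_abs : (\int[mu]_x `|h x| = 0)%E.
  by under eq_integral do rewrite gee0_abs//.
by move=> /(_ measurableT mh); apply: filterS => x; exact.
Qed.

Lemma integrable_density (R : realType) (d : measure_display)
    (T : measurableType d) (mu : {measure set T -> \bar R}) (f : T -> R) :
  measurable_fun [set: T] f -> (forall x, 0 <= f x) ->
  (\int[mu]_x (f x)%:E = 1)%E -> mu.-integrable [set: T] (EFin \o f).
Proof.
move=> mf f0 f1; apply/integrableP; split; first exact/measurable_EFinP.
by under eq_integral do rewrite /= ger0_norm//; rewrite f1 ltry.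
Qed.

(** * The nonnegative divergence integrand and the change of reference density *)

(* The integrand [a log (a / b) - a + b] of the divergence in its nonnegative
   form, with values [b] at [a = 0] and [+oo] at [b = 0 < a]. *)
Definition kl_gap {R : realType} (a b : R) : \bar R :=
  if a == 0 then b%:E
  else if b == 0 then +oo%E
  else (a * (ln a - ln b) - a + b)%:E.

(** With [t = ln b - ln a] one has [b = a e^t], so the gap is [a (e^t - 1 - t)] and its sign is read
    off from [e^t >= 1 + t]. *)
Lemma kl_gap_pos (R : realType) (a b : R) : 0 < a -> 0 < b ->
  a * (ln a - ln b) - a + b = a * (expR (ln b - ln a) - (1 + (ln b - ln a))).
Proof.
move=> a0 b0; rewrite expRD expRN !lnK ?posrE//.
by field; rewrite gt_eqF.
Qed.

Lemma kl_gap_ge0 (R : realType) (a b : R) : 0 <= a -> 0 <= b ->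
  (0 <= kl_gap a b)%E.
Proof.
rewrite /kl_gap => a0 b0; case: eqVneq => [_|an0]; first by rewrite lee_fin.
case: eqVneq => [//|bn0]; rewrite lee_fin kl_gap_pos ?lt_def ?an0 ?bn0//.
by rewrite mulr_ge0// subr_ge0 expR_ge1Dx.
Qed.

(** For positive arguments, the strict inequality [e^t > 1 + t] at [t != 0] forces the logarithms to
    agree. *)
Lemma kl_gap_eq0 (R : realType) (a b : R) : 0 <= a -> 0 <= b ->
  kl_gap a b = 0%E -> a = b.
Proof.
rewrite /kl_gap => a0 b0; case: eqVneq => [-> [->]//|an0].
case: eqVneq => [//|bn0].
have pa : 0 < a by rewrite lt_def an0.
have pb : 0 < b by rewrite lt_def bn0.
case; rewrite kl_gap_pos// => /eqP; rewrite mulf_eq0 (negPf an0)/= => /eqP e.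
apply/eqP; rewrite -(inj_in_eq (@ln_inj R)) ?posrE// eq_sym -subr_eq0.
apply: contraT => /expR_gt1Dx; rewrite -subr_gt0 e ltxx.
by [].
Qed.

Lemma kl_gapxx (R : realType) (a : R) : kl_gap a a = 0%E.
Proof.
rewrite /kl_gap; case: eqVneq => [->//|_].
by rewrite subrr mulr0 sub0r addNr.
Qed.

Lemma measurable_kl_gap (R : realType) (d : measure_display)
    (T : measurableType d) (f g : T -> R) :
  measurable_fun [set: T] f -> measurable_fun [set: T] g ->
  measurable_fun [set: T] (fun x => kl_gap (f x) (g x)).
Proof.
move=> mf mg; rewrite /kl_gap.
have mln (h : T -> R) : measurable_fun [set: T] h ->
    measurable_fun [set: T] (fun x => ln (h x)).
  by move=> mh; apply: measurableT_comp mh; exact: measurable_ln.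
apply: measurable_fun_ifT; first exact: measurable_fun_eqr.
  exact/measurable_EFinP.
apply: measurable_fun_ifT => //; first exact: measurable_fun_eqr.
apply/measurable_EFinP/measurable_funD => //.
apply: measurable_funB => //; apply: measurable_funM => //.
by apply: measurable_funB; exact: mln.
Qed.

(* The integrand of [KL f g] splits into a nonnegative gap towards the tilted
   density [g e^s] and a real-valued term, so that no [+oo - oo] can occur. *)
Lemma KL_tilt (R : realType) (d : measure_display) (T : measurableType d)
    (mu : {sigma_finite_measure set T -> \bar R}) (f g s : T -> R) :
  measurable_fun [set: T] f -> measurable_fun [set: T] g ->
  measurable_fun [set: T] s ->
  (forall x, 0 <= f x) -> (forall x, 0 <= g x) ->
  (\int[mu]_x (f x)%:E = 1)%E ->
  (\int[mu]_x (g x * expR (s x))%:E = 1)%E ->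
  mu.-integrable [set: T] (fun x => (s x * f x)%:E) ->
  KL mu f g = (\int[mu]_x kl_gap (f x) (g x * expR (s x))
               + \int[mu]_x (s x * f x)%:E)%E.
Proof.
move=> mf mg ms f0 g0 f1 g1 isf.
have mes : measurable_fun [set: T] (fun x => g x * expR (s x)).
  by apply: measurable_funM => //; exact: measurableT_comp.
have if_ : mu.-integrable [set: T] (EFin \o f) by exact: integrable_density.
have ig : mu.-integrable [set: T] (EFin \o (fun x => g x * expR (s x))).
  by apply: integrable_density => // x; rewrite mulr_ge0 ?expR_ge0.
(* The real-valued remainder. Its second bracket is a difference of two densities and integrates to
   0. *)
pose v x := s x * f x + (f x - g x * expR (s x)).
have ifg : mu.-integrable [set: T] (EFin \o (fun x => f x - g x * expR (s x))).
  exact: (integrableB measurableT if_ ig).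
have iv : mu.-integrable [set: T] (EFin \o v).
  exact: (integrableD measurableT isf ifg).
(* The identity is pointwise. Where [f = 0] the gap [g e^s] is cancelled by [v]; where [g = 0 < f]
   both sides are [+oo]. *)
transitivity (\int[mu]_x (kl_gap (f x) (g x * expR (s x)) + (v x)%:E))%E.
  apply: eq_integral => x _; rewrite /kl_gap /v.
  case: eqVneq => [->|fn0].
    by rewrite mulr0 sub0r add0r -EFinD subrr.
  rewrite mulf_eq0 [expR _ == 0]gt_eqF ?expR_gt0// orbF.
  case: eqVneq => [_|gn0]; first by [].
  have pf : 0 < f x by rewrite lt_def fn0 f0.
  have pg : 0 < g x by rewrite lt_def gn0 g0.
  rewrite -EFinD ln_div ?posrE// lnM ?posrE ?expR_gt0// expRK.
  by congr EFin; ring.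
rewrite ge0_integralDr//; last first.
- by move=> x; rewrite kl_gap_ge0// mulr_ge0// expR_ge0.
- exact: measurable_kl_gap.
congr (_ + _)%E; rewrite /v; under eq_integral do rewrite EFinD.
rewrite (integralD _ isf ifg)//; under [X in (_ + X)%E]eq_integral do rewrite /= EFinB.
by rewrite integralB_EFin// f1 g1 subee// adde0.
Qed.

(** * Measurability tools *)

(** On nonnegative reals, 0 included, inversion is the power with exponent -1. *)
Lemma measurable_ge0_funV (R : realType) (d : measure_display)
    (T : measurableType d) (f : T -> R) :
  (forall x, 0 <= f x) -> measurable_fun [set: T] f ->
  measurable_fun [set: T] (fun x => (f x)^-1).
Proof.
move=> f0 mf; under eq_fun => x do rewrite -powR_inv1//.
exact: (measurableT_comp (measurable_powR (-1)) mf).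
Qed.

Lemma measurable_funT_bool (R : realType) (d : measure_display)
    (T : measurableType d) (F : T -> bool -> R) (b : T -> bool) :
  (forall c, measurable_fun [set: T] (F ^~ c)) -> measurable_fun [set: T] b ->
  measurable_fun [set: T] (fun x => F x (b x)).
Proof.
move=> mF mb.
have -> : (fun x => F x (b x)) = (fun x => if b x then F x true else F x false).
  by apply/funext => x; case: (b x).
by apply: measurable_fun_ifT => //; exact: mF.
Qed.

Lemma measurable_bool_set (d : measure_display) (T : measurableType d)
    (b : T -> bool) : measurable_fun [set: T] b -> measurable [set x | b x = true].
Proof.
move=> mb; rewrite -[X in measurable X]setTI.
exact: (mb measurableT [set true]).
Qed.

(** * Policies, their success probability, and integrals of functions of the reward *)

Section policies.
Context {R : realType} {dQ dO : measure_display}.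
Context {Q : measurableType dQ} {O : measurableType dO}.
Context (mu : {sigma_finite_measure set O -> \bar R}) (r : Q -> O -> bool).
Context (r_meas : measurable_fun [set: Q * O] (fun x : Q * O => r x.1 x.2)).

Lemma measurable_reward_section (q : Q) : measurable_fun [set: O] (r q).
Proof. exact: (measurable_fun_pair2 q r_meas). Qed.

Lemma measurable_policy_section (pi : Q -> O -> R) (q : Q) :
  is_policy mu pi -> measurable_fun [set: O] (pi q).
Proof. by case=> mpi _ _; exact: (measurable_fun_pair2 q mpi). Qed.

Lemma integrable_policy (pi : Q -> O -> R) (q : Q) :
  is_policy mu pi -> mu.-integrable [set: O] (EFin \o pi q).
Proof.
move=> ppi; have [_ pi0 pi1] := ppi.
by apply: integrable_density => //; exact: measurable_policy_section.
Qed.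

(** The success integral is finite, so [fine] loses nothing, and the total mass 1 splits into
    success and failure. *)
Lemma success_probE (pi : Q -> O -> R) (q : Q) : is_policy mu pi ->
  [/\ (\int[mu]_(o in [set o | r q o = true]) (pi q o)%:E
         = (success_prob mu r pi q)%:E)%E,
      (\int[mu]_(o in ~` [set o | r q o = true]) (pi q o)%:E
         = (1 - success_prob mu r pi q)%:E)%E
    & 0 <= success_prob mu r pi q <= 1].
Proof.
move=> ppi; have [_ pi0 pi1] := ppi.
have mB := measurable_bool_set _ _ _ (measurable_reward_section q).
have mpi : measurable_fun [set: O] (EFin \o pi q).
  by apply/measurable_EFinP; exact: measurable_policy_section.
have split1 : (\int[mu]_(o in [set o | r q o = true]) (pi q o)%:E
    + \int[mu]_(o in ~` [set o | r q o = true]) (pi q o)%:E = 1)%E.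
  rewrite -ge0_integral_setU ?setUv//; first exact: measurableC.
  - by move=> o _; rewrite lee_fin.
  - by apply/disj_setPCl; exact: subset_refl.
have E1 : (\int[mu]_(o in [set o | r q o = true]) (pi q o)%:E
    = (success_prob mu r pi q)%:E)%E.
  rewrite /success_prob fineK//.
  apply: integrable_fin_num => //.
  by apply: integrableS (integrable_policy _ _ ppi).
have B0 : (0 <= \int[mu]_(o in [set o | r q o = true]) (pi q o)%:E)%E.
  by apply: integral_ge0 => o _; rewrite lee_fin.
have C0 : (0 <= \int[mu]_(o in ~` [set o | r q o = true]) (pi q o)%:E)%E.
  by apply: integral_ge0 => o _; rewrite lee_fin.
have E2 : (\int[mu]_(o in ~` [set o | r q o = true]) (pi q o)%:E
    = (1 - success_prob mu r pi q)%:E)%E.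
  by rewrite EFinB -split1 E1 addeAC subee// add0e.
split=> //; apply/andP; split; first by rewrite -lee_fin -E1.
by rewrite -subr_ge0 -lee_fin -E2.
Qed.

(** The factor [F (r q o)] takes two values, hence is bounded by [|F true| + |F false|]. *)
Lemma integrable_reward (F : bool -> R) (pi : Q -> O -> R) (q : Q) :
  is_policy mu pi -> mu.-integrable [set: O] (fun o => (F (r q o) * pi q o)%:E).
Proof.
move=> ppi; have [_ pi0 _] := ppi.
apply: (le_integrable measurableT _ _
  (integrableZl measurableT (`|F true| + `|F false|) (integrable_policy pi q ppi))).
- apply/measurable_EFinP/measurable_funM.
    apply: (measurable_funT_bool _ _ _ (fun=> F)) => //.
    exact: measurable_reward_section.
  exact: measurable_policy_section.
- move=> o _; rewrite /= lee_fin !normrM ler_wpM2r//.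
  by rewrite [leRHS]ger0_norm ?addr_ge0//; case: (r q o); rewrite ?lerDl ?lerDr.
Qed.

(** [F (r q o)] is constant on the success set and on its complement. Every expectation below
    (advantage, exponent, normalization, success probability) is an instance. *)
Lemma integral_reward (F : bool -> R) (pi : Q -> O -> R) (q : Q) :
  is_policy mu pi ->
  (\int[mu]_o (F (r q o) * pi q o)%:E =
   (F true * success_prob mu r pi q
    + F false * (1 - success_prob mu r pi q))%:E)%E.
Proof.
move=> ppi; have [E1 E2 _] := success_probE pi q ppi.
have mB := measurable_bool_set _ _ _ (measurable_reward_section q).
have mF : measurable_fun [set: O] (fun o => (F (r q o) * pi q o)%:E).
  by case/integrableP: (integrable_reward F pi q ppi).
have ipi := integrable_policy pi q ppi.
rewrite -(setUv [set o | r q o = true]) integral_setU ?setUv//; last 2 first.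
- exact: measurableC.
- by apply/disj_setPCl; exact: subset_refl.
have iB : mu.-integrable [set o | r q o = true] (EFin \o pi q).
  exact: integrableS ipi.
have iC : mu.-integrable (~` [set o | r q o = true]) (EFin \o pi q).
  by apply: integrableS ipi => //; exact: measurableC.
rewrite EFinD !EFinM -E1 -E2 -(integralZl mB iB) -(integralZl (measurableC mB) iC).
congr (_ + _)%E; apply: eq_integral => o; rewrite inE/=.
  by move=> ->; rewrite EFinM.
by case: (r q o) => // _; rewrite EFinM.
Qed.

Lemma measurable_success_prob (pi : Q -> O -> R) :
  is_policy mu pi -> measurable_fun [set: Q] (success_prob mu r pi).
Proof.
move=> [mpi pi0 _].
pose F (x : Q * O) := (if r x.1 x.2 then pi x.1 x.2 else 0)%:E.
have mF : measurable_fun [set: Q * O] F.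
  by apply/measurable_EFinP; exact: measurable_fun_ifT.
have F0 x : (0 <= F x)%E by rewrite lee_fin; case: ifP.
(* Extending the density by 0 outside the success set gives a function on the product, to which
   Tonelli applies. *)
have -> : success_prob mu r pi = fine \o fubini_F mu F.
  apply/funext => q; rewrite /success_prob integral_mkcond.
  congr (fine _); apply: eq_integral => o _; rewrite patchE /F /=.
  by case: (boolP (r q o)) => h; [rewrite mem_set|rewrite memNset//=; exact/negP].
apply: measurableT_comp; last exact: measurable_fun_fubini_tonelli_F.
exact: fine_measurable.
Qed.

(** * The tilted policy and bounds on its normalization *)

(** The logarithm of the factor from the old density to the tilted one. Keeping the normalization in
    the exponent gives the tilt the form [g e^s] of [KL_tilt]. *)
Definition gibbs_exponent (beta eps p : R) (b : bool) : R :=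
  beta^-1 * advantage eps p b - ln (mirror_grpo_Z beta eps p).

Definition gibbs_tilt (beta eps : R) (pi : Q -> O -> R) (q : Q) (o : O) : R :=
  pi q o * expR (gibbs_exponent beta eps (success_prob mu r pi q) (r q o)).

Lemma mirror_grpo_Z_gt0 (beta eps p : R) : 0 <= p <= 1 ->
  0 < mirror_grpo_Z beta eps p.
Proof.
move=> /andP[p0 p1]; rewrite /mirror_grpo_Z.
have [->|pn0] := eqVneq p 0; first by rewrite mul0r add0r subr0 mul1r expR_gt0.
rewrite ltr_pwDl ?mulr_gt0 ?expR_gt0 ?lt_def ?pn0//.
by rewrite mulr_ge0 ?expR_ge0// subr_ge0.
Qed.

Lemma gibbs_tiltE (beta eps : R) (pi : Q -> O -> R) (q : Q) (o : O) :
  is_policy mu pi ->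
  gibbs_tilt beta eps pi q o =
  (mirror_grpo_Z beta eps (success_prob mu r pi q))^-1 * pi q o *
  expR (beta^-1 * advantage eps (success_prob mu r pi q) (r q o)).
Proof.
move=> ppi; have [_ _ p01] := success_probE pi q ppi.
rewrite /gibbs_tilt /gibbs_exponent expRD expRN lnK; last first.
  by rewrite posrE mirror_grpo_Z_gt0.
by ring.
Qed.

Lemma mirror_grpo_Z_expR (beta eps p : R) :
  mirror_grpo_Z beta eps p = p * expR (beta^-1 * advantage eps p true)
    + (1 - p) * expR (beta^-1 * advantage eps p false).
Proof. by rewrite /mirror_grpo_Z /= mulrN. Qed.

(** The factor depends on the reward alone, so the mass is the two-term sum defining [Z], divided by
    [Z]. *)
Lemma integral_gibbs_tilt (beta eps : R) (pi : Q -> O -> R) (q : Q) :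
  is_policy mu pi -> (\int[mu]_o (gibbs_tilt beta eps pi q o)%:E = 1)%E.
Proof.
move=> ppi; have [_ _ p01] := success_probE pi q ppi.
set p := success_prob mu r pi q in p01.
have Z0 := mirror_grpo_Z_gt0 beta eps p p01.
pose F b := expR (gibbs_exponent beta eps p b).
under eq_integral => o _ do rewrite /gibbs_tilt mulrC -/(F (r q o)).
rewrite (integral_reward F)// -/p /F /gibbs_exponent !expRD expRN lnK ?posrE//.
congr EFin; rewrite -[RHS](divff (lt0r_neq0 Z0)).
by rewrite [X in _ = X / _]mirror_grpo_Z_expR; ring.
Qed.

Lemma measurable_advantage (beta eps : R) (p : Q -> R) :
  measurable_fun [set: Q] p -> forall b,
  measurable_fun [set: Q] (fun q => advantage eps (p q) b).
Proof.
move=> mp b.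
have m1p : measurable_fun [set: Q] (fun q => 1 - p q) by exact: measurable_funB.
have msqrt : measurable_fun [set: Q] (fun q => (Num.sqrt (p q * (1 - p q) + eps))^-1).
  apply: measurable_ge0_funV; first by move=> q; exact: sqrtr_ge0.
  apply: (measurableT_comp (continuous_measurable_fun (@sqrt_continuous R))).
  by apply: measurable_funD => //; exact: measurable_funM.
case: b; rewrite /advantage /omega_plus /omega_minus; first exact: measurable_funM.
by apply: measurableT_comp => //; exact: measurable_funM.
Qed.

Lemma measurable_ln_mirror_grpo_Z (beta eps : R) (p : Q -> R) :
  measurable_fun [set: Q] p ->
  measurable_fun [set: Q] (fun q => ln (mirror_grpo_Z beta eps (p q))).
Proof.
move=> mp; apply: (measurableT_comp (@measurable_ln R)).
under eq_fun => q do rewrite mirror_grpo_Z_expR.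
have m1p : measurable_fun [set: Q] (fun q => 1 - p q) by exact: measurable_funB.
have mexp b : measurable_fun [set: Q] (fun q => expR (beta^-1 * advantage eps (p q) b)).
  apply: (measurableT_comp (@measurable_expR R)).
  by apply: measurable_funM => //; exact: measurable_advantage.
by apply: measurable_funD; apply: measurable_funM => //; exact: mexp.
Qed.

Lemma gibbs_tilt_policy (beta eps : R) (pi : Q -> O -> R) :
  is_policy mu pi -> is_policy mu (gibbs_tilt beta eps pi).
Proof.
move=> ppi; have [mpi pi0 pi1] := ppi.
split; last by move=> q; exact: integral_gibbs_tilt.
  rewrite /gibbs_tilt; apply: measurable_funM => //.
  apply: (measurableT_comp (@measurable_expR R)).
  apply: (measurable_funT_bool _ _ _
    (fun x c => gibbs_exponent beta eps (success_prob mu r pi x.1) c)) => // c.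
  have mp := measurable_success_prob pi ppi.
  apply: (@measurableT_comp _ _ _ _ _ _
    (fun q => gibbs_exponent beta eps (success_prob mu r pi q) c) _ fst) => //.
  rewrite /gibbs_exponent; apply: measurable_funB.
    by apply: measurable_funM => //; exact: measurable_advantage.
  exact: measurable_ln_mirror_grpo_Z.
by move=> q o; rewrite mulr_ge0 ?expR_ge0.
Qed.

(** The numerators [p] and [1 - p] lie in [0, 1], and the root in the denominator is at least
    [sqrt eps]. *)
Lemma advantage_bound (eps p : R) (b : bool) : 0 < eps -> 0 <= p <= 1 ->
  `|advantage eps p b| <= (Num.sqrt eps)^-1.
Proof.
move=> eps0 /andP[p0 p1].
have pp : 0 <= p * (1 - p) by rewrite mulr_ge0// subr_ge0.
have s0 : 0 < Num.sqrt eps by rewrite sqrtr_gt0.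
have t0 : 0 < Num.sqrt (p * (1 - p) + eps) by rewrite sqrtr_gt0 ltr_wpDl.
have le1 : (Num.sqrt (p * (1 - p) + eps))^-1 <= (Num.sqrt eps)^-1.
  by rewrite lef_pV2 ?posrE// ler_wsqrtr// lerDr.
have bnd x : 0 <= x <= 1 ->
    `|x / Num.sqrt (p * (1 - p) + eps)| <= (Num.sqrt eps)^-1.
  move=> /andP[x0 x1]; rewrite ger0_norm ?divr_ge0 ?(ltW t0)//.
  by apply: le_trans le1; rewrite ler_piMl// invr_ge0 ltW.
case: b; rewrite /advantage /omega_plus /omega_minus ?normrN; apply: bnd.
  by rewrite subr_ge0 p1/= gerBl.
by rewrite p0.
Qed.

(** [Z] is a convex combination of two exponentials whose exponents lie in [[- M, M]]. *)
Lemma ln_mirror_grpo_Z_bound (beta eps p : R) :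
  0 < beta -> 0 < eps -> 0 <= p <= 1 ->
  `|ln (mirror_grpo_Z beta eps p)| <= beta^-1 * (Num.sqrt eps)^-1.
Proof.
move=> beta0 eps0 p01; have Z0 := mirror_grpo_Z_gt0 beta eps p p01.
set M := beta^-1 * _.
have adv b : - M <= beta^-1 * advantage eps p b <= M.
  rewrite -ler_norml normrM gtr0_norm ?invr_gt0//.
  by rewrite ler_wpM2l ?invr_ge0 ?(ltW beta0)//; exact: advantage_bound.
have /andP[t1 t2] := adv true; have /andP[f1 f2] := adv false.
move: p01 => /andP[p0 p1]; have q0 : 0 <= 1 - p by rewrite subr_ge0.
have convex a : a = p * a + (1 - p) * a by ring.
rewrite ler_norml; apply/andP; split; rewrite -ler_expR lnK ?posrE//
  mirror_grpo_Z_expR.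
  rewrite [leLHS](convex (expR (- M))).
  by rewrite lerD ?ler_wpM2l ?ler_expR.
rewrite [leRHS](convex (expR M)).
by rewrite lerD ?ler_wpM2l ?ler_expR.
Qed.

(** * The objective and its maximizers *)

Context (rho : probability Q R).

(** Bounded on a probability space. The integral is the optimal value, and its finiteness lets it be
    cancelled when objectives are compared. *)
Lemma integrable_ln_mirror_grpo_Z (beta eps : R) (pi : Q -> O -> R) :
  0 < beta -> 0 < eps -> is_policy mu pi ->
  rho.-integrable [set: Q] (EFin \o (fun q =>
    beta * ln (mirror_grpo_Z beta eps (success_prob mu r pi q)))).
Proof.
move=> beta0 eps0 ppi.
apply: (@le_integrable _ _ _ rho _ measurableT _
  (EFin \o cst (Num.sqrt eps)^-1)).
- apply/measurable_EFinP/measurable_funM => //.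
  by apply: measurable_ln_mirror_grpo_Z; exact: measurable_success_prob.
- move=> q _; rewrite /= lee_fin normrM gtr0_norm// [leRHS]ger0_norm; last first.
    by rewrite invr_ge0 sqrtr_ge0.
  have [_ _ p01] := success_probE pi q ppi.
  by rewrite -ler_pdivlMl//; exact: ln_mirror_grpo_Z_bound.
- exact: finite_measure_integrable_cst.
Qed.

Lemma measurable_integral_kl_gap (pi pi' : Q -> O -> R) :
  is_policy mu pi -> is_policy mu pi' ->
  measurable_fun [set: Q] (fun q => \int[mu]_o kl_gap (pi' q o) (pi q o))%E.
Proof.
move=> [mpi pi0 _] [mpi' pi'0 _].
apply: (measurable_fun_fubini_tonelli_F
  (fun x => kl_gap (pi' x.1 x.2) (pi x.1 x.2))) => //.
  exact: measurable_kl_gap.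
by move=> x; exact: kl_gap_ge0.
Qed.

(** For each [q], [KL_tilt] with the Gibbs exponent as [s] gives the Gibbs identity; the outer
    integral then splits by [ge0_integralBr], even if the expected gap is infinite. *)
Lemma mirror_grpo_objectiveE (beta eps : R) (pi pi' : Q -> O -> R) :
  0 < beta -> 0 < eps -> is_policy mu pi -> is_policy mu pi' ->
  mirror_grpo_objective rho mu r beta eps pi pi' =
  (\int[rho]_q (beta * ln (mirror_grpo_Z beta eps (success_prob mu r pi q)))%:E
   - \int[rho]_q (beta%:E *
       \int[mu]_o kl_gap (pi' q o) (gibbs_tilt beta eps pi q o)))%E.
Proof.
move=> beta0 eps0 ppi ppi'.
have [mpi pi0 pi1] := ppi; have [mpi' pi'0 pi'1] := ppi'.
have [mt t0 t1] := gibbs_tilt_policy beta eps pi ppi.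
pose p q := success_prob mu r pi q.
pose c q := beta * ln (mirror_grpo_Z beta eps (p q)).
pose D q := (\int[mu]_o kl_gap (pi' q o) (gibbs_tilt beta eps pi q o))%E.
have D0 q : (0 <= D q)%E by apply: integral_ge0 => o _; exact: kl_gap_ge0.
have mD : measurable_fun [set: Q] D.
  by apply: measurable_integral_kl_gap => //; exact: gibbs_tilt_policy.
have ic : rho.-integrable [set: Q] (EFin \o c).
  exact: integrable_ln_mirror_grpo_Z.
have mh : measurable_fun [set: Q] (fun q => beta%:E * D q)%E.
  exact: measurable_funeM.
have h0 q : (0 <= beta%:E * D q)%E by rewrite mule_ge0 ?lee_fin ?(ltW beta0).
rewrite -(ge0_integralBr _ _ _ rho _ c mh h0 ic).
apply: eq_integral => q _; rewrite -/(p q).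
rewrite (KL_tilt _ _ _ _ _ _ (fun o => gibbs_exponent beta eps (p q) (r q o)))//.
- rewrite (integral_reward (gibbs_exponent beta eps (p q)))//.
  rewrite (integral_reward (advantage eps (p q)))//.
  rewrite -[integral _ _ _]/(D q).
  rewrite muleDr//; last exact: fin_num_adde_defl.
  rewrite fin_num_oppeD// addeCA addeC; congr (_ + _)%E.
  (* Only reals remain: the advantage terms cancel, and the weights of success and failure under
     [pi'] sum to 1, which leaves [beta ln Z]. *)
  rewrite -EFinM -EFinN -EFinD /c /gibbs_exponent; congr EFin.
  set A1 := advantage _ _ _; set A2 := advantage _ _ _.
  by field; rewrite gt_eqF.
- exact: measurable_policy_section.
- exact: measurable_policy_section.
- apply: (measurable_funT_bool _ _ _ (fun=> gibbs_exponent beta eps (p q))) => //.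
  exact: measurable_reward_section.
- exact: integral_gibbs_tilt.
- exact: integrable_reward.
Qed.

Lemma gibbs_tilt_objective (beta eps : R) (pi : Q -> O -> R) :
  0 < beta -> 0 < eps -> is_policy mu pi ->
  mirror_grpo_objective rho mu r beta eps pi (gibbs_tilt beta eps pi) =
  (\int[rho]_q
     (beta * ln (mirror_grpo_Z beta eps (success_prob mu r pi q)))%:E)%E.
Proof.
move=> beta0 eps0 ppi.
rewrite mirror_grpo_objectiveE//; last exact: gibbs_tilt_policy.
rewrite [X in (_ - X)%E]integral0_eq ?sube0// => q _.
by rewrite integral0_eq ?mule0// => o _; exact: kl_gapxx.
Qed.

Lemma gibbs_tilt_maximizer (beta eps : R) (pi : Q -> O -> R) :
  0 < beta -> 0 < eps -> is_policy mu pi ->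
  is_policy_maximizer mu (mirror_grpo_objective rho mu r beta eps pi)
    (gibbs_tilt beta eps pi).
Proof.
move=> beta0 eps0 ppi; split; first exact: gibbs_tilt_policy.
move=> pi' ppi'; have [mt t0 t1] := gibbs_tilt_policy beta eps pi ppi.
have [_ pi'0 _] := ppi'.
rewrite gibbs_tilt_objective// mirror_grpo_objectiveE// geeDl// leeNl oppe0.
apply: integral_ge0 => q _; rewrite mule_ge0 ?lee_fin ?(ltW beta0)//.
by apply: integral_ge0 => o _; exact: kl_gap_ge0.
Qed.

Lemma maximizer_ae_gibbs_tilt (beta eps : R) (pi pi' : Q -> O -> R) :
  0 < beta -> 0 < eps -> is_policy mu pi ->
  is_policy_maximizer mu (mirror_grpo_objective rho mu r beta eps pi) pi' ->
  {ae rho, forall q, {ae mu, forall o, pi' q o = gibbs_tilt beta eps pi q o}}.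
Proof.
move=> beta0 eps0 ppi [ppi' max].
have ptilt := gibbs_tilt_policy beta eps pi ppi.
have [mt t0 t1] := ptilt; have [_ pi'0 _] := ppi'.
have gap0 q o : (0 <= kl_gap (pi' q o) (gibbs_tilt beta eps pi q o))%E.
  exact: kl_gap_ge0.
have D0 q :
    (0 <= beta%:E * \int[mu]_o kl_gap (pi' q o) (gibbs_tilt beta eps pi q o))%E.
  by rewrite mule_ge0 ?lee_fin ?(ltW beta0)//; exact: integral_ge0.
have D_eq0 : (\int[rho]_q (beta%:E *
    \int[mu]_o kl_gap (pi' q o) (gibbs_tilt beta eps pi q o)) = 0)%E.
  (* Compare with the tilted policy, which attains the constant: cancelling the constant leaves an
     expected gap at most 0. *)
  apply/eqP; rewrite eq_le integral_ge0// andbT.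
  have := max _ ptilt; rewrite gibbs_tilt_objective// mirror_grpo_objectiveE//.
  rewrite -[X in (X <= _)%E]adde0 leeD2lE; first by rewrite leeNr oppe0.
  by apply: integrable_fin_num => //; exact: integrable_ln_mirror_grpo_Z.
have := ge0_integral_eq0_ae _ _ _ rho _
  (measurable_funeM _ (measurable_integral_kl_gap _ _ ptilt ppi')) D0 D_eq0.
(* For almost every [q] the inner integral vanishes, and the same argument in [o] makes the gap zero
   almost everywhere. *)
apply: filterS => q /eqP; rewrite mule_eq0 eqe gt_eqF//= => /eqP D_q0.
have mgap : measurable_fun [set: O]
    (fun o => kl_gap (pi' q o) (gibbs_tilt beta eps pi q o)).
  by apply: measurable_kl_gap; exact: measurable_policy_section.
have := ge0_integral_eq0_ae _ _ _ mu _ mgap (gap0 q) D_q0.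
by apply: filterS => o; exact: kl_gap_eq0.
Qed.

Lemma success_prob_gibbs_tilt (beta eps : R) (pi pi' : Q -> O -> R) (q : Q) :
  is_policy mu pi -> is_policy mu pi' ->
  {ae mu, forall o, pi' q o = gibbs_tilt beta eps pi q o} ->
  success_prob mu r pi' q =
  success_prob mu r pi q *
    expR (gibbs_exponent beta eps (success_prob mu r pi q) true).
Proof.
move=> ppi ppi' ae_eq.
pose p := success_prob mu r pi q.
(* Writing the success indicator as [b%:R] turns both probabilities into integrals over all
   outcomes, where almost everywhere equality transfers directly. *)
have E1 := integral_reward (fun b => b%:R) pi' q ppi'.
have E2 := integral_reward
  (fun b => b%:R * expR (gibbs_exponent beta eps p b)) pi q ppi.
have [E] : ((success_prob mu r pi' q)%:E =
    (success_prob mu r pi q *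
      expR (gibbs_exponent beta eps (success_prob mu r pi q) true))%:E)%E.
  transitivity (\int[mu]_o ((r q o)%:R * pi' q o)%:E)%E.
    by rewrite E1 mul1r mul0r addr0.
  rewrite mulrC; transitivity (\int[mu]_o
      ((r q o)%:R * expR (gibbs_exponent beta eps p (r q o)) * pi q o)%:E)%E.
    apply: ae_eq_integral => //.
    - by case/integrableP: (integrable_reward (fun b => b%:R) pi' q ppi').
    - by case/integrableP: (integrable_reward
        (fun b => b%:R * expR (gibbs_exponent beta eps p b)) pi q ppi).
    - apply: filterS ae_eq => o -> _.
      by rewrite /gibbs_tilt -mulrA [pi q o * _]mulrC.
  by rewrite E2 mul1r !mul0r addr0.
exact: E.
Qed.

End policies.

(** * The recurrence on the logit scale *)

Lemma logitK (R : realType) (p : R) : 0 <= p <= 1 -> sigmoid (logit p) = p.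
Proof.
move=> /andP[p0 p1]; rewrite /logit.
have [->//|pn0] := eqVneq p 0; have [->//|pn1] := eqVneq p 1.
have pp : 0 < p by rewrite lt_def pn0.
have qq : 0 < 1 - p by rewrite subr_gt0 lt_def eq_sym pn1.
rewrite /sigmoid expRN lnK ?posrE ?divr_gt0//.
by field; rewrite !gt_eqF//=; lra.
Qed.

Lemma omega_plusD_minus (R : realType) (eps p : R) :
  omega_plus eps p + omega_minus eps p = Omega_eps eps p.
Proof.
by rewrite /omega_plus /omega_minus /Omega_eps -mulrDl subrK mul1r.
Qed.

(** The tilt multiplies the success mass by [e1 / Z] and the failure mass by [e2 / Z], hence the
    odds by [e1 / e2 = exp (Omega / beta)]. *)
Lemma logit_gibbs_tilt (R : realType) (beta eps p p' : R) : 0 <= p <= 1 ->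
  p' = p * expR (gibbs_exponent beta eps p true) ->
  logit p' = (logit p + (Omega_eps eps p / beta)%:E)%E.
Proof.
move=> p01; have Z0 := mirror_grpo_Z_gt0 beta eps p p01.
have ZE := mirror_grpo_Z_expR beta eps p.
rewrite /gibbs_exponent expRD expRN lnK ?posrE//.
set Z := mirror_grpo_Z _ _ _ in Z0 ZE *.
set e1 := expR _ in ZE *; set e2 := expR _ in ZE.
have e10 : 0 < e1 by exact: expR_gt0.
have e20 : 0 < e2 by exact: expR_gt0.
move: (p01) => /andP[p0 p1] p'E; rewrite /logit.
(* The endpoints are fixed points: 0 is only rescaled, and at 1 one has [Z = e1]. Both sides are
   then the same infinity. *)
have [p_eq0|pn0] := eqVneq p 0.
  by rewrite p'E p_eq0 mul0r eqxx.
have [p_eq1|pn1] := eqVneq p 1.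
  rewrite p'E ZE p_eq1 subrr !mul0r addr0 !mul1r divff ?(lt0r_neq0 e10)//.
  by rewrite oner_eq0 eqxx.
have pp : 0 < p by rewrite lt_def pn0.
have qq : 0 < 1 - p by rewrite subr_gt0 lt_def eq_sym pn1.
have q'E : 1 - p' = (1 - p) * (e2 / Z).
  by rewrite p'E -[1 in LHS](divff (lt0r_neq0 Z0)) [X in X / _ - _]ZE; ring.
have p'0 : 0 < p' by rewrite p'E mulr_gt0// divr_gt0.
have q'0 : 0 < 1 - p' by rewrite q'E mulr_gt0// divr_gt0.
have p'1 : p' < 1 by rewrite -subr_gt0.
have -> : (p' == 0) = false by exact: gt_eqF.
have -> : (p' == 1) = false by exact: lt_eqF.
rewrite -EFinD; congr EFin.
have -> : p' / (1 - p') = p / (1 - p) * (e1 / e2).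
  by rewrite q'E p'E; field; rewrite !lt0r_neq0.
rewrite lnM ?posrE ?divr_gt0//; congr (_ + _).
rewrite ln_div ?posrE// !expRK -omega_plusD_minus /advantage.
by ring.
Qed.

(** * Existence of the iterates, and their form along any sequence of maximizers *)

Theorem theorem4 (R : realType) (dQ dO : measure_display)
    (Q : measurableType dQ) (O : measurableType dO)
    (rho : probability Q R) (mu : {sigma_finite_measure set O -> \bar R})
    (r : Q -> O -> bool)
    (r_meas : measurable_fun [set: Q * O] (fun x : Q * O => r x.1 x.2))
    (pi_ref : Q -> O -> R) (pi_ref_policy : is_policy mu pi_ref)
    (beta eps : R) (beta_gt0 : 0 < beta) (eps_gt0 : 0 < eps) (eps_le1 : eps <= 1) :
  (exists pi : nat -> Q -> O -> R,
     mirror_grpo_iterates rho mu r beta eps pi_ref pi) /\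
  forall pi : nat -> Q -> O -> R,
    mirror_grpo_iterates rho mu r beta eps pi_ref pi ->
    {ae rho, forall q : Q, forall n : nat,
      let p := success_prob mu r (pi n) q in
      let p' := success_prob mu r (pi n.+1) q in
      [/\ {ae mu, forall o : O,
            pi n.+1 q o =
              (mirror_grpo_Z beta eps p)^-1 * pi n q o *
              expR (beta^-1 * (omega_plus eps p * (r q o == true)%:R
                               - omega_minus eps p * (r q o == false)%:R))},
          logit p' = (logit p + (Omega_eps eps p / beta)%:E)%E
        & p' = sigmoid (logit p + (Omega_eps eps p / beta)%:E)%E]}.
Proof.
split.
  (* Iterating the tilt gives an exact maximizer at each step. *)
  pose pi n := iter n (gibbs_tilt mu r beta eps) pi_ref.
  have ppi n : is_policy mu (pi n).
    by elim: n => [//|n ppi]; exact: gibbs_tilt_policy.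
  exists pi; split; first exact: erefl.
  by move=> n; exact: (gibbs_tilt_maximizer _ _ r_meas rho _ _ (pi n)).
move=> pi [pi0E max].
have ppi n : is_policy mu (pi n).
  by case: n => [|n]; [rewrite pi0E|case: (max n)].
(* There are countably many [n], so one null set of prompts serves all of them. *)
apply: ae_foralln => n.
have := maximizer_ae_gibbs_tilt _ _ r_meas rho _ _ _ _ beta_gt0 eps_gt0 (ppi n) (max n).
apply: filterS => q ae_eq.
set p := success_prob _ _ (pi n) q; set p' := success_prob _ _ (pi n.+1) q.
have [_ _ p01] := success_probE _ _ r_meas (pi n) q (ppi n).
have [_ _ p'01] := success_probE _ _ r_meas (pi n.+1) q (ppi n.+1).
have p'E := success_prob_gibbs_tilt _ _ r_meas _ _ _ _ q (ppi n) (ppi n.+1) ae_eq.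
have logitE := logit_gibbs_tilt _ _ _ _ _ p01 p'E.
split=> //; last by rewrite -logitE logitK.
apply: filterS ae_eq => o ->; rewrite gibbs_tiltE// -/p.
congr (_ * expR (_ * _)); rewrite /advantage.
by case: (r q o); rewrite /= ?mulr1 ?mulr0 ?subr0 ?sub0r.
Qed.
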